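(* Let $0\le q\le 1/2$. For the binary doubly-dirty multiple access channel $Y=X_1\oplus X_2\oplus S_1\oplus S_2$ with identical input constraints $q_1=q_2=q$, the best known single-letter rate region $\mathcal{R}_{BSL}(q)$ is strictly contained in the capacity region of the channel.
   Context: Notation: $\oplus$ is addition mod 2 (componentwise on vectors), $w_H(\cdot)$ is Hamming weight, $\log=\log_2$, all information quantities are in bits. Channel: two users have inputs $X_1,X_2\in\{0,1\}$ and the output is $Y=X_1\oplus X_2\oplus S_1\oplus S_2$. The interference sequences $\mathbf{s}_1,\mathbf{s}_2\in\{0,1\}^n$ have i.i.d. Bernoulli$(1/2)$ entries and are independent of each other and of the messages. User $i$ knows the whole sequence $\mathbf{s}_i$ in advance (non-causally) but not the other user's interference; the receiver knows neither. Capacity region: a code of block length $n$ consists of message sets $\mathcal{W}_1,\mathcal{W}_2$, encoders $\mathbf{x}_i=\phi_i(W_i,\mathbf{s}_i)\in\{0,1\}^n$ satisfying $\frac1n w_H(\mathbf{x}_i)\le q$ for $i=1,2$, and a decoder producing $(\hat W_1,\hat W_2)$ from $\mathbf{y}=\mathbf{x}_1\oplus\mathbf{x}_2\oplus\mathbf{s}_1\oplus\mathbf{s}_2$. The rates are $R_i=\frac1n\log|\mathcal{W}_i|$. The error probability is $\Pr\{(\hat W_1,\hat W_2)\ne(W_1,W_2)\}$ where $W_1,W_2$ are independent and uniform. A pair $(R_1,R_2)$ of nonnegative reals is achievable if there is a sequence of codes, with $n\to\infty$, whose rates converge to $(R_1,R_2)$ and whose error probability tends to $0$. The capacity region is the closure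 of the set of achievable pairs. Pentagonal regions: consider joint distributions of $(S_1,S_2,U_1,U_2,X_1,X_2,Y)$, with $S_1,S_2$ independent Bernoulli$(1/2)$, $U_1,U_2$ auxiliary random variables in finite alphabets, $X_1,X_2\in\{0,1\}$, such that $P(U_1,U_2,X_1,X_2|S_1,S_2)=P(U_1,X_1|S_1)\,P(U_2,X_2|S_2)$ and $Y=X_1\oplus X_2\oplus S_1\oplus S_2$. For such a distribution let $\mathcal{R}(U_1,U_2)$ be the set of pairs $(R_1,R_2)$ with $R_1,R_2\ge0$ and $$R_1\le I(U_1;Y|U_2)-I(U_1;S_1),\quad R_2\le I(U_2;Y|U_1)-I(U_2;S_2),$$ $$R_1+R_2\le I(U_1,U_2;Y)-I(U_1;S_1)-I(U_2;S_2).$$ Best known single-letter region: $\mathcal{R}_{BSL}(q)$ is the closure of the convex hull of the set of all rate pairs $(R_1,R_2)$ belonging to $\mathcal{R}(U_1,U_2)$ for some such joint distribution, with the additional input constraints $EX_1\le q$, $EX_2\le q$.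
   Formalization: Containment is stated for all 0 ≤ q ≤ 1/2, but strictness only for 0 < q < 1/2, because at q = 0 both regions are {(0,0)} and at q = 1/2 both are {R1, R2 ≥ 0, R1+R2 ≤ 1}. *)

(* Defs.v *)
From HB Require Import structures.
From mathcomp Require Import all_boot all_order all_algebra.
From mathcomp Require Import all_classical all_reals all_analysis.

Set Implicit Arguments.
Unset Strict Implicit.
Unset Printing Implicit Defensive.

Import Order.TTheory GRing.Theory Num.Theory.
Import numFieldNormedType.Exports.

Local Open Scope classical_set_scope.
Local Open Scope ring_scope.

(* Bits are elements of 'F_2 and binary words of length n are row vectors over
   'F_2, so that addition modulo 2 is the addition of 'F_2 and of 'rV['F_2]_n. *)

Definition log2 (R : realType) (x : R) : R := ln x / ln 2.

Definition hamming_weight (n : nat) (x : 'rV['F_2]_n) : nat :=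
  #|[set j : 'I_n | x 0%R j != 0]%SET|.

Definition fair_bit (R : realType) (b : 'F_2) : R :=
  bernoulli_pmf (2^-1 : R) (b == 1).

Definition iid_fair_bits (R : realType) (n : nat) (s : 'rV['F_2]_n) : R :=
  \prod_(j < n) fair_bit R (s 0 j).

Record block_code (R : realType) (q : R) (n : nat) := BlockCode {
  msg1 : finType;
  msg2 : finType;
  msg1_gt0 : (0 < #|msg1|)%N;
  msg2_gt0 : (0 < #|msg2|)%N;
  enc1 : msg1 -> 'rV['F_2]_n -> 'rV['F_2]_n;
  enc2 : msg2 -> 'rV['F_2]_n -> 'rV['F_2]_n;
  enc1_weight : forall w s, (hamming_weight (enc1 w s))%:R / n%:R <= q;
  enc2_weight : forall w s, (hamming_weight (enc2 w s))%:R / n%:R <= q;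
  dec : 'rV['F_2]_n -> msg1 * msg2
}.

Section code_performance.
Variables (R : realType) (q : R) (n : nat) (c : block_code q n).

Definition rate1 : R := log2 #|msg1 c|%:R / n%:R.
Definition rate2 : R := log2 #|msg2 c|%:R / n%:R.

Definition channel_output (w : msg1 c * msg2 c) (s1 s2 : 'rV['F_2]_n) :
    'rV['F_2]_n :=
  enc1 w.1 s1 + enc2 w.2 s2 + s1 + s2.

Definition error_probability : R :=
  \sum_(w : msg1 c * msg2 c) \sum_(s1 : 'rV['F_2]_n) \sum_(s2 : 'rV['F_2]_n)
    #|msg1 c|%:R^-1 * #|msg2 c|%:R^-1
    * iid_fair_bits R s1 * iid_fair_bits R s2
    * (dec c (channel_output w s1 s2) != w)%:R.

End code_performance.

(* The carrier is R^o * R^o rather than R * R because the library's convex sets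
   are subsets of an lmodType. There is one code for every block length, and the
   degenerate length 0 does not affect the limits. *)
Definition achievable (R : realType) (q : R) : set (R^o * R^o) :=
  [set r | [/\ 0 <= r.1, 0 <= r.2 &
    exists c : forall n : nat, block_code q n,
      [/\ rate1 (c n) @[n --> \oo] --> (r.1 : R),
          rate2 (c n) @[n --> \oo] --> (r.2 : R) &
          error_probability (c n) @[n --> \oo] --> (0 : R)]]].

Definition capacity_region (R : realType) (q : R) : set (R^o * R^o) :=
  closure (achievable q).

Record fdist (R : realType) (T : finType) := FDist {
  fdist_pmf :> T -> R;
  fdist_ge0 : forall t, 0 <= fdist_pmf t;
  fdist_sum1 : \sum_t fdist_pmf t = 1
}.

Notation "[% X , Y , .. , Z ]" := (fun w => (.. (X w, Y w) .., Z w))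
  (at level 0, X at level 99, Y at level 99, Z at level 99).

Section information.
Variables (R : realType) (Omega : finType) (P : fdist R Omega).

Definition prob (A : finType) (X : Omega -> A) (a : A) : R :=
  \sum_(w | X w == a) P w.

Definition cond_prob (A B : finType) (X : Omega -> A) (Y : Omega -> B)
    (a : A) (b : B) : R :=
  prob [% X, Y] (a, b) / prob Y b.

Definition mean_bit (X : Omega -> 'F_2) : R :=
  \sum_w P w * (X w : nat)%:R.

(* In both sums a term with zero joint probability is 0, and in every other
   term all the denominators are positive. *)
Definition mutual_info (A B : finType) (X : Omega -> A) (Y : Omega -> B) : R :=
  \sum_a \sum_b prob [% X, Y] (a, b)
    * log2 (prob [% X, Y] (a, b) / (prob X a * prob Y b)).

Definition cond_mutual_info (A B C : finType)
    (X : Omega -> A) (Y : Omega -> B) (Z : Omega -> C) : R :=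
  \sum_a \sum_b \sum_c prob [% X, Y, Z] (a, b, c)
    * log2 (cond_prob [% X, Y] Z (a, b) c
            / (cond_prob X Z a c * cond_prob Y Z b c)).

End information.

(* A joint distribution of (S1, S2, U1, U2, X1, X2) is given by random variables
   on a finite probability space. *)
Record test_channel (R : realType) := TestChannel {
  sample_space : finType;
  law : fdist R sample_space;
  aux1 : finType;
  aux2 : finType;
  S1 : sample_space -> 'F_2;
  S2 : sample_space -> 'F_2;
  U1 : sample_space -> aux1;
  U2 : sample_space -> aux2;
  X1 : sample_space -> 'F_2;
  X2 : sample_space -> 'F_2;
  S1S2_law : forall s1 s2,
    prob law [% S1, S2] (s1, s2) = fair_bit R s1 * fair_bit R s2;
  UX_law : forall u1 u2 x1 x2 s1 s2,
    cond_prob law [% U1, U2, X1, X2] [% S1, S2] (u1, u2, x1, x2) (s1, s2) =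
    cond_prob law [% U1, X1] S1 (u1, x1) s1
    * cond_prob law [% U2, X2] S2 (u2, x2) s2
}.

Section single_letter.
Variable R : realType.

Definition output (t : test_channel R) : sample_space t -> 'F_2 :=
  fun w => X1 w + X2 w + S1 w + S2 w.

Definition pentagon (t : test_channel R) : set (R^o * R^o) :=
  let P := law t in
  [set r | [/\ 0 <= r.1 /\ 0 <= r.2,
     r.1 <= cond_mutual_info P (@U1 _ t) (@output t) (@U2 _ t)
            - mutual_info P (@U1 _ t) (@S1 _ t),
     r.2 <= cond_mutual_info P (@U2 _ t) (@output t) (@U1 _ t)
            - mutual_info P (@U2 _ t) (@S2 _ t) &
     r.1 + r.2 <= mutual_info P [% @U1 _ t, @U2 _ t] (@output t)
                  - mutual_info P (@U1 _ t) (@S1 _ t)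
                  - mutual_info P (@U2 _ t) (@S2 _ t)]].

Definition convex_hull (A : set (R^o * R^o)) : set (R^o * R^o) :=
  smallest (fun B => convex_set (B : set (convex_lmodType (R^o * R^o)%type))) A.

Definition R_BSL (q : R) : set (R^o * R^o) :=
  closure (convex_hull
    [set r | exists t : test_channel R,
       [/\ mean_bit (law t) (@X1 _ t) <= q, mean_bit (law t) (@X2 _ t) <= q &
           pentagon t r]]).

End single_letter.

(* Main.v *)
Require Import Defs.
From HB Require Import structures.
From mathcomp Require Import all_boot all_order all_algebra.
From mathcomp Require Import all_classical all_reals all_analysis.
From mathcomp Require Import ring lra zify.

Import Order.TTheory GRing.Theory Num.Theory.
Import numFieldNormedType.Exports.

Local Open Scope classical_set_scope.
Local Open Scope ring_scope.

(* Write [h] for the binary entropy, [T_i = X_i + S_i], so that [Y = T_1 + T_2].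

   Outer bound on single-letter rates.  The sum rate of a test channel is at most
   H(S1|U1) + H(S2|U2) - H(Y|U1,U2) - 1, and H(Y|U1,U2) >= H(T_i|U_i) for both i,
   hence it is at most the mean of the two numbers E[2 h(a) - h(t) - 1], where a and t
   are the conditional laws of S_i and T_i given U_i, and E|a - t| <= q.  For
   0 < rho <= 1 one has 2 h(a) - h(t) - 1 <= c - 2 (log rho) |a - t| with
   c = max(0, 2 log (1 + rho) - 1).  Taking rho^2 = q / (1 - q) bounds the sum rate by
   c - 2 q log rho, which is smaller than h(q) for 0 < q < 1/2 and equal to it for q = 1/2.
   This constraint is closed and convex, so it passes to R_BSL.

   Inner bound on the capacity region.  A linear code K whose Hamming balls of radius qn
   cover the space and whose codimension is n (h(q) - o(1)) exists by Goblick's greedy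
   argument.  User i sends a word of weight at most qn in the coset v_i(W_i) + s_i + K;
   the output then lies in v_1(W_1) + v_2(W_2) + K, which determines both messages without
   error as soon as the total number of message bits is at most the codimension of K.
   Hence every pair with R1 + R2 <= h(q) is in the capacity region. *)

(** * Entropy inequalities *)

Section entropy_inequalities.
Variable R : realType.
Implicit Types a d l m rho t x y z : R.

Definition xlnx x : R := x * ln x.

(* In nats, whereas the information quantities of the statement are in bits. *)
Definition bin_entropy x : R := - (xlnx x + xlnx (1 - x)).

Lemma xlnx0 : xlnx 0 = 0. Proof. by rewrite /xlnx mul0r. Qed.

Lemma xlnx1 : xlnx 1 = 0. Proof. by rewrite /xlnx ln1 mulr0. Qed.

Lemma xlnxM x y : 0 <= x -> 0 <= y -> xlnx (x * y) = y * xlnx x + x * xlnx y.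
Proof.
rewrite !le_eqVlt => /predU1P[<-|x0] /predU1P[<-|y0];
  rewrite ?(mul0r, mulr0, xlnx0, addr0) //.
by rewrite /xlnx lnM ?posrE //; ring.
Qed.

(** The left-hand side is the tangent line of the convex function [xlnx] at [z]; the bound is
    [ln (1 + u) <= u] at [u = z / x - 1]. *)
Lemma xlnx_ge x z : 0 <= x -> 0 < z -> x * ln z + (x - z) <= xlnx x.
Proof.
rewrite le_eqVlt => /predU1P[<-|x0] z0; first by rewrite xlnx0; lra.
have zx : -1 < z / x - 1 by have := divr_gt0 z0 x0; lra.
have := le_ln1Dx zx; rewrite addrCA subrr addr0 ln_div ?posrE //.
move=> /(ler_wpM2l (ltW x0)); rewrite mulrBr mulrBr mulr1 mulrCA divff ?gt_eqF //.
by rewrite /xlnx; lra.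
Qed.

(** Both points are compared with the tangent at the mixture [z], where the linear terms cancel on
    averaging; [z = 0] has no tangent and is treated apart. *)
Lemma convex_xlnx l x y : 0 <= l <= 1 -> 0 <= x -> 0 <= y ->
  xlnx (l * x + (1 - l) * y) <= l * xlnx x + (1 - l) * xlnx y.
Proof.
move=> /andP[l0 l1] x0 y0; set z := l * x + _.
have z0 : 0 <= z by rewrite addr_ge0 // mulr_ge0 // subr_ge0.
move: z0; rewrite le_eqVlt => /predU1P[z0|z0].
  rewrite -z0 xlnx0.
  have lx : l * x = 0.
    have : 0 <= l * x by rewrite mulr_ge0.
    have : 0 <= (1 - l) * y by rewrite mulr_ge0 // subr_ge0.
    by move: z0; rewrite /z; lra.
  have ly : (1 - l) * y = 0 by move: z0; rewrite /z lx add0r.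
  by rewrite /xlnx !mulrA lx ly !mul0r addr0.
have l1' : 0 <= 1 - l by rewrite subr_ge0.
have := ler_wpM2l l0 (xlnx_ge _ _ x0 z0).
have := ler_wpM2l l1' (xlnx_ge _ _ y0 z0).
rewrite {3}/xlnx.
have -> : z * ln z = l * (x * ln z + (x - z)) + (1 - l) * (y * ln z + (y - z)).
  by rewrite /z; ring.
lra.
Qed.

(** Gibbs' inequality against the Bernoulli law of parameter [rho / (1 + rho)], at which the bound
    is the tangent of the entropy. *)
Lemma bin_entropy_le rho a : 0 < rho -> 0 <= a <= 1 ->
  bin_entropy a <= ln (1 + rho) - a * ln rho.
Proof.
move=> r0 /andP[a0 a1].
have s0 : 0 < 1 + rho by lra.
have := xlnx_ge a (rho / (1 + rho)) a0 (divr_gt0 r0 s0).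
have a1' : 0 <= 1 - a by lra.
have i0 : 0 < (1 + rho)^-1 by rewrite invr_gt0.
have := xlnx_ge (1 - a) _ a1' i0.
rewrite ln_div ?posrE // lnV ?posrE // /bin_entropy.
have : rho / (1 + rho) + (1 + rho)^-1 = 1.
  by rewrite -{2}[(1 + rho)^-1]mul1r -mulrDl addrC divff ?gt_eqF.
lra.
Qed.

Lemma bin_entropy_le_ln2 a : 0 <= a <= 1 -> bin_entropy a <= ln 2.
Proof.
move=> h; have := bin_entropy_le 1 a ltr01 h.
by rewrite ln1 mulr0 subr0.
Qed.

Lemma bin_entropy_chord l a : 0 <= l <= 1 -> 0 <= a <= 1 ->
  l * bin_entropy a <= bin_entropy (l * a).
Proof.
move=> hl /andP[a0 a1].
have a1' : 0 <= 1 - a by lra.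
have := convex_xlnx l a 0 hl a0 (lexx _).
have := convex_xlnx l (1 - a) 1 hl a1' ler01.
have -> : l * (1 - a) + (1 - l) * 1 = 1 - l * a by ring.
have -> : l * a + (1 - l) * 0 = l * a by ring.
rewrite /bin_entropy xlnx0 xlnx1; lra.
Qed.

Lemma bin_entropyC a : bin_entropy (1 - a) = bin_entropy a.
Proof. by rewrite /bin_entropy subKr addrC. Qed.

(* For fixed [a] the left-hand side minus [- 2 * ln rho * `|a - t|] is convex
   in [t] on each of [0, a] and [a, 1], so only [t = 0, a, 1] matter. *)
Lemma entropy_gap_le rho c a t : 0 < rho <= 1 -> 0 <= c ->
  2 * ln (1 + rho) - ln 2 <= c -> 0 <= a <= 1 -> 0 <= t <= 1 ->
  2 * bin_entropy a - bin_entropy t - ln 2 <= c - 2 * ln rho * `|a - t|.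
Proof.
move=> /andP[r0 r1] c0 hc.
have key : forall a t, 0 <= t <= a -> a <= 1 ->
    2 * bin_entropy a - bin_entropy t - ln 2 <= c - 2 * ln rho * (a - t).
  move=> {}a {}t /andP[t0 ta] a1.
  have a0 : 0 <= a by exact: le_trans ta.
  have ha : 0 <= a <= 1 by rewrite a0 a1.
  move: (a0); rewrite le_eqVlt => /predU1P[a00|a0'].
    have t00 : t = 0 by apply/eqP; rewrite eq_le t0 a00 ta.
    rewrite -a00 t00 subr0 mulr0 subr0 /bin_entropy subr0 xlnx0 xlnx1.
    by have := ln_gt0 (ltr1n R 2); rewrite addr0; lra.
  pose l := t / a.
  have l0 : 0 <= l by rewrite divr_ge0.
  have l1 : l <= 1 by rewrite ler_pdivrMr // mul1r.
  have hl : 0 <= l <= 1 by rewrite l0 l1.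
  have tE : t = l * a by rewrite /l divfK // gt_eqF.
  have h1 := bin_entropy_chord l a hl ha.
  have h2 := bin_entropy_le rho a r0 ha.
  have h3 := bin_entropy_le_ln2 a ha.
  rewrite tE.
  have l1' : 0 <= 1 - l by lra.
  (* This is the case [t = 0], and [h3] serves [t = a]. By the chord bound [h1], [t = l * a] follows
     by mixing them with weights [1 - l] and [l]. *)
  have h4 : 2 * bin_entropy a - ln 2 <= c - 2 * ln rho * a by lra.
  have := ler_wpM2l l1' h4.
  have := ler_wpM2l l0 h3.
  have : 0 <= l * c by rewrite mulr_ge0.
  lra.
move=> /andP[a0 a1] /andP[t0 t1].
case: (leP t a) => [ta|/ltW ta].
  by rewrite ger0_norm ?subr_ge0 //; apply: key => //; rewrite t0 ta.
(* Exchanging the two bit values turns [a < t] into the case already proved. *)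
rewrite ler0_norm ?subr_le0 // -(bin_entropyC a) -(bin_entropyC t).
have -> : - (a - t) = (1 - a) - (1 - t) by ring.
apply: key; last by lra.
by apply/andP; split; lra.
Qed.

Lemma split_entropy m x y : 0 < m -> 0 <= x -> 0 <= y -> x + y = m ->
  xlnx x + xlnx y = xlnx m - m * bin_entropy (x / m).
Proof.
move=> m0 x0 y0 xy.
have i0 : 0 <= m^-1 by rewrite invr_ge0 ltW.
have xE : x = m * (x / m) by rewrite mulrC divfK ?gt_eqF.
have yE : y = m * (1 - x / m) by rewrite mulrBr mulr1 -xE; lra.
have d0 : 0 <= x / m by rewrite mulr_ge0.
have d1 : 0 <= 1 - x / m by rewrite subr_ge0 ler_pdivrMr // mul1r -xy lerDl.
rewrite {1}xE {1}yE (xlnxM m (x / m)) ?(ltW m0) // (xlnxM m (1 - x / m)) ?(ltW m0) // /bin_entropy.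
ring.
Qed.

(* [f0, f1] and [g0, g1] are the laws of [S] and of [X + S] restricted to a value of
   the auxiliary variable of probability [m], and [d] bounds the part of
   [P (X = 1)] on that event. *)
Lemma local_entropy_gap rho c (f0 f1 g0 g1 m d : R) : 0 < rho <= 1 -> 0 <= c ->
  2 * ln (1 + rho) - ln 2 <= c ->
  0 <= f0 -> 0 <= f1 -> 0 <= g0 -> 0 <= g1 -> f0 + f1 = m -> g0 + g1 = m ->
  `|f0 - g0| <= d ->
  (xlnx g0 + xlnx g1) - 2 * (xlnx f0 + xlnx f1) + xlnx m - m * ln 2
    <= c * m - 2 * ln rho * d.
Proof.
move=> hr c0 hc f00 f10 g00 g10 fm gm hd.
have lr : ln rho <= 0 by apply: ln_le0; case/andP: hr.
have m0 : 0 <= m by rewrite -fm addr_ge0.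
have hd' : 0 <= - (2 * ln rho) * (d - `|f0 - g0|).
  by rewrite mulr_ge0 // ?subr_ge0 // oppr_ge0; lra.
move: m0; rewrite le_eqVlt => /predU1P[m0|m0].
  have [-> -> -> ->] : [/\ f0 = 0, f1 = 0, g0 = 0 & g1 = 0].
    by split; lra.
  rewrite -m0 xlnx0 !(mul0r, mulr0, addr0, subr0, add0r).
  have d0 : 0 <= d by exact: le_trans hd.
  by have : 0 <= - ln rho * d; [rewrite mulr_ge0 // oppr_ge0|lra].
rewrite (split_entropy m f0 f1) // (split_entropy m g0 g1) //.
have h01 : forall x y, 0 <= x -> 0 <= y -> x + y = m -> 0 <= x / m <= 1.
  move=> x y x0 y0 xy; rewrite divr_ge0 ?(ltW m0) //=.
  by rewrite ler_pdivrMr // mul1r -xy lerDl.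
have := entropy_gap_le rho c (f0 / m) (g0 / m) hr c0 hc (h01 _ _ f00 f10 fm)
  (h01 _ _ g00 g10 gm).
rewrite -mulrBl normrM (ger0_norm (x := m^-1)) ?invr_ge0 ?(ltW m0) //.
move=> /(ler_wpM2l (ltW m0)).
rewrite [X in _ <= X -> _]mulrBr.
have -> : m * (2 * ln rho * (`|f0 - g0| / m)) = 2 * ln rho * `|f0 - g0|.
  by rewrite mulrCA; congr (_ * _); rewrite mulrCA divff ?mulr1 // gt_eqF.
lra.
Qed.

End entropy_inequalities.

Arguments xlnx {R} x.
Arguments bin_entropy {R} x.

(** * Entropy on finite probability spaces *)

Lemma sum_F2 (V : zmodType) (F : 'F_2 -> V) : \sum_t F t = F 0 + F 1.
Proof.
rewrite !big_ord_recl big_ord0 addr0.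
by congr (F _ + F _); apply/val_inj.
Qed.

Section finite_probability.
Variables (R : realType) (Omega : finType) (P : fdist R Omega).
Implicit Types A B C D : finType.

Lemma prob_ge0 A (X : Omega -> A) a : 0 <= prob P X a.
Proof. by apply: sumr_ge0 => w _; exact: fdist_ge0. Qed.

Lemma eq_prob A B (X : Omega -> A) (Y : Omega -> B) a b :
  (forall w, (X w == a) = (Y w == b)) -> prob P X a = prob P Y b.
Proof. by move=> XY; apply: eq_bigl => w; rewrite XY. Qed.

Lemma sum_prob A (X : Omega -> A) : \sum_a prob P X a = 1.
Proof.
by rewrite -(fdist_sum1 P) (partition_big X xpredT).
Qed.

Lemma sum_prob_joint A B (X : Omega -> A) (Y : Omega -> B) a :
  \sum_b prob P [% X, Y] (a, b) = prob P X a.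
Proof.
by rewrite /prob (partition_big Y xpredT).
Qed.

Lemma prob_jointC A B (X : Omega -> A) (Y : Omega -> B) a b :
  prob P [% X, Y] (a, b) = prob P [% Y, X] (b, a).
Proof. by apply: eq_prob => w; rewrite !xpair_eqE andbC. Qed.

Lemma prob_joint_le A B (X : Omega -> A) (Y : Omega -> B) a b :
  prob P [% X, Y] (a, b) <= prob P X a.
Proof.
rewrite -(sum_prob_joint A B X Y) (bigD1 b) //= lerDl sumr_ge0 // => *.
exact: prob_ge0.
Qed.

Lemma prob_comp A C (X : Omega -> A) (f : A -> C) c :
  prob P (f \o X) c = \sum_(a | f a == c) prob P X a.
Proof.
rewrite /prob (partition_big X (fun a => f a == c)) //=.
apply: eq_bigr => a /eqP <-; apply: eq_bigl => w.
by case: (X w =P a) => [->|]; rewrite ?eqxx ?andbF.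
Qed.

Definition independent {A B} (X : Omega -> A) (Y : Omega -> B) :=
  forall a b, prob P [% X, Y] (a, b) = prob P X a * prob P Y b.

Lemma independent_comp A B C D (X : Omega -> A) (Y : Omega -> B) (f : A -> C) (g : B -> D) :
  independent X Y -> independent (f \o X) (g \o Y).
Proof.
move=> XY c d; rewrite !prob_comp.
rewrite (_ : prob P _ _ = prob P ((fun ab => (f ab.1, g ab.2)) \o [% X, Y]) (c, d)) //.
rewrite prob_comp big_distrlr /= pair_big /=.
by apply: eq_big => [[a b]|[a b] _]; [rewrite xpair_eqE | rewrite XY].
Qed.

Definition neg_entropy {A} (X : Omega -> A) : R := \sum_a xlnx (prob P X a).

(** The factor [ln 2] converts bits into nats. *)
Lemma mutual_infoE A B (X : Omega -> A) (Y : Omega -> B) :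
  mutual_info P X Y * ln 2 = neg_entropy [% X, Y] - neg_entropy X - neg_entropy Y.
Proof.
have l2 : ln 2 != 0 :> R by rewrite gt_eqF // ln_gt0 // ltr1n.
have hX : neg_entropy X = \sum_a \sum_b prob P [% X, Y] (a, b) * ln (prob P X a).
  by apply: eq_bigr => a _; rewrite -big_distrl /= sum_prob_joint.
have hY : neg_entropy Y = \sum_a \sum_b prob P [% X, Y] (a, b) * ln (prob P Y b).
  rewrite exchange_big /=; apply: eq_bigr => b _; rewrite -big_distrl /=.
  by under eq_bigr do rewrite prob_jointC; rewrite sum_prob_joint.
have hXY : neg_entropy [% X, Y] = \sum_a \sum_b xlnx (prob P [% X, Y] (a, b)).
  by rewrite /neg_entropy pair_big /=; apply: eq_bigr => -[].
rewrite hX hY hXY /mutual_info big_distrl -!sumrB; apply: eq_bigr => a _ /=.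
rewrite big_distrl -!sumrB; apply: eq_bigr => b _ /=.
set p := prob P [% X, Y] (a, b).
have : 0 <= p by exact: prob_ge0.
rewrite le_eqVlt => /predU1P[<-|p0]; first by rewrite xlnx0 !mul0r !subr0.
have pX : 0 < prob P X a by apply: lt_le_trans p0 _; exact: prob_joint_le.
have pY : 0 < prob P Y b.
  by apply: lt_le_trans p0 _; rewrite /p prob_jointC; exact: prob_joint_le.
rewrite /log2 ln_div ?posrE ?mulr_gt0 // lnM ?posrE // -mulrA divfK // /xlnx; ring.
Qed.

Lemma neg_entropy_independent A B (X : Omega -> A) (Y : Omega -> B) :
  independent X Y -> neg_entropy [% X, Y] = neg_entropy X + neg_entropy Y.
Proof.
move=> XY; rewrite /neg_entropy.
rewrite (_ : \sum_(ab : A * B) _ = \sum_a \sum_b xlnx (prob P [% X, Y] (a, b))); last first.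
  by rewrite pair_big /=; apply: eq_bigr => -[].
under eq_bigr do under eq_bigr do rewrite XY xlnxM ?prob_ge0 //.
under eq_bigr do rewrite big_split /= -big_distrl -big_distrr /= sum_prob mul1r.
by rewrite big_split /= -big_distrl /= sum_prob mul1r.
Qed.

Lemma neg_entropy_bit (Y : Omega -> 'F_2) : - ln 2 <= neg_entropy Y.
Proof.
have := sum_prob _ Y; rewrite /neg_entropy !sum_F2 => h.
have p0 := prob_ge0 _ Y 0; have p1 := prob_ge0 _ Y 1.
have -> : prob P Y 1 = 1 - prob P Y 0 by rewrite -h addrC addKr.
rewrite -lerN2 opprK; apply: bin_entropy_le_ln2; lra.
Qed.

Lemma neg_entropy_fair_bit (Y : Omega -> 'F_2) :
  (forall y, prob P Y y = 2^-1) -> neg_entropy Y = - ln 2.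
Proof.
move=> hY; rewrite /neg_entropy sum_F2 !hY /xlnx lnV ?posrE //.
by field.
Qed.

(** The convolution of the masses (a, b) and (c, d) on 'F_2 is a mixture of (a, b) and its swap (b,
    a) with weights proportional to c and d, so convexity of [xlnx] applies. *)
Lemma xlnx_convolution_le (a b c d : R) : 0 <= a -> 0 <= b -> 0 <= c -> 0 <= d ->
  xlnx (a * c + b * d) + xlnx (b * c + a * d)
    <= (c + d) * (xlnx a + xlnx b) + (a + b) * xlnx (c + d).
Proof.
move=> a0 b0 c0 d0; have : 0 <= c + d by rewrite addr_ge0.
rewrite le_eqVlt => /predU1P[cd|cd].
  have [-> ->] : c = 0 /\ d = 0 by split; lra.
  by rewrite !(mulr0, mul0r, addr0, xlnx0).
pose l := c / (c + d).
have cE : c = (c + d) * l by rewrite /l mulrC divfK // gt_eqF.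
have dE : d = (c + d) * (1 - l) by lra.
have hl : 0 <= l <= 1.
  by rewrite divr_ge0 ?(ltW cd) //= ler_pdivrMr // mul1r lerDl.
have /andP[l0 l1] := hl.
have l1' : 0 <= 1 - l by lra.
have mix x y : 0 <= x -> 0 <= y -> xlnx (x * c + y * d) <=
   (l * x + (1 - l) * y) * xlnx (c + d) + (c + d) * (l * xlnx x + (1 - l) * xlnx y).
  move=> x0 y0.
  have -> : x * c + y * d = (c + d) * (l * x + (1 - l) * y).
    transitivity (x * ((c + d) * l) + y * ((c + d) * (1 - l))); last by ring.
    by rewrite -cE -dE.
  have m0 : 0 <= l * x + (1 - l) * y by rewrite addr_ge0 // mulr_ge0.
  rewrite (xlnxM _ _ _ (ltW cd) m0) lerD2l.
  by rewrite ler_wpM2l ?(ltW cd) // convex_xlnx.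
have := mix a b a0 b0; have := mix b a b0 a0.
lra.
Qed.

(** In entropies, H(S + T | U, V) >= H(S | U): adding an independent bit cannot lower the entropy.
    It is the convolution bound summed over all values of U and V. *)
Lemma neg_entropy_sum_le A B (U : Omega -> A) (V : Omega -> B) (S T : Omega -> 'F_2) :
  independent [% U, S] [% V, T] ->
  neg_entropy [% U, V, fun w => S w + T w] <= neg_entropy [% U, S] + neg_entropy V.
Proof.
move=> ind.
pose g u s := prob P [% U, S] (u, s); pose h v t := prob P [% V, T] (v, t).
have gU u : prob P U u = g u 0 + g u 1 by rewrite -(sum_prob_joint _ _ U S) sum_F2.
have hV v : prob P V v = h v 0 + h v 1 by rewrite -(sum_prob_joint _ _ V T) sum_F2.
have joint u v y : prob P [% U, V, fun w => S w + T w] (u, v, y) =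
    g u y * h v 0 + g u (y - 1) * h v 1.
  have ST t w : (S w + T w == y) && (T w == t) = (S w == y - t) && (T w == t).
    by case: (T w =P t) => [->|]; rewrite ?andbF // [in RHS]eq_sym subr_eq eq_sym.
  rewrite -(sum_prob_joint _ _ _ T) sum_F2 -[in g u y](subr0 y) -!ind.
  by congr (_ + _); apply: eq_prob => w; rewrite !xpair_eqE -andbA ST; do !case: eqP.
rewrite /neg_entropy.
have -> : \sum_p xlnx (prob P [% U, V, fun w => S w + T w] p) =
    \sum_u \sum_v (xlnx (g u 0 * h v 0 + g u 1 * h v 1) +
                   xlnx (g u 1 * h v 0 + g u 0 * h v 1)).
  transitivity (\sum_(uv : A * B) \sum_y
      xlnx (prob P [% U, V, fun w => S w + T w] (uv, y))).
    by rewrite pair_big /=; apply: eq_bigr => -[].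
  rewrite [RHS]pair_big /=; apply: eq_bigr => -[u v] _ /=.
  rewrite sum_F2 !joint; congr (xlnx (_ + g u _ * _) + xlnx (_ + g u _ * _));
    exact/val_inj.
apply: (@le_trans _ _ (\sum_u \sum_v (prob P V v * (xlnx (g u 0) + xlnx (g u 1)) +
   prob P U u * xlnx (prob P V v)))).
  apply: ler_sum => u _; apply: ler_sum => v _; rewrite gU hV.
  by apply: xlnx_convolution_le; exact: prob_ge0.
under eq_bigr do rewrite big_split /= -big_distrl -big_distrr /= sum_prob mul1r.
rewrite big_split /= -big_distrl /= sum_prob mul1r lerD2r.
rewrite le_eqVlt; apply/orP; left; apply/eqP.
transitivity (\sum_u \sum_s xlnx (g u s)).
  by apply: eq_bigr => u _; rewrite sum_F2.
by rewrite pair_big /=; apply: eq_bigr => -[].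
Qed.

Lemma mean_bitE (X : Omega -> 'F_2) : mean_bit P X = prob P X 1.
Proof.
rewrite /mean_bit /prob [RHS]big_mkcond; apply: eq_bigr => w _.
by case: (X w) => [[|[|]]] //= ?; rewrite ?mulr0 ?mulr1.
Qed.

(** The left-hand side is 2 H(S | U) - H(X + S | U) - ln 2; the local bound is summed over the
    values of U. *)
Lemma dirty_entropy_gap A (U : Omega -> A) (X S : Omega -> 'F_2) (rho c : R) :
    0 < rho <= 1 -> 0 <= c -> 2 * ln (1 + rho) - ln 2 <= c ->
  neg_entropy [% U, fun w => X w + S w] - 2 * neg_entropy [% U, S] + neg_entropy U
    - ln 2 <= c - 2 * ln rho * mean_bit P X.
Proof.
move=> hr c0 hc.
pose T w := X w + S w.
have bits (Y : Omega -> 'F_2) : neg_entropy [% U, Y] =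
    \sum_u (xlnx (prob P [% U, Y] (u, 0)) + xlnx (prob P [% U, Y] (u, 1))).
  transitivity (\sum_u \sum_y xlnx (prob P [% U, Y] (u, y))).
    by rewrite pair_big /=; apply: eq_bigr => -[].
  by apply: eq_bigr => u _; rewrite sum_F2.
have -> : mean_bit P X = \sum_u prob P [% U, X] (u, 1).
  by rewrite mean_bitE -(sum_prob_joint _ _ X U); apply: eq_bigr => u _; exact: prob_jointC.
have -> : c = \sum_u c * prob P U u by rewrite -big_distrr /= sum_prob mulr1.
have -> : ln 2 = \sum_u prob P U u * ln 2 :> R by rewrite -big_distrl /= sum_prob mul1r.
rewrite !bits /neg_entropy !big_distrr -!sumrB -big_split -sumrB; apply: ler_sum => u _ /=.
have marg (Y : Omega -> 'F_2) : prob P [% U, Y] (u, 0) + prob P [% U, Y] (u, 1) = prob P U u.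
  by rewrite -(sum_prob_joint _ _ U Y) sum_F2.
apply: local_entropy_gap => //; rewrite ?prob_ge0 //.
(* S and X + S differ only where X = 1, so the masses they give to 0 differ by [p 0 1 - p 1 1], at
   most P(U = u, X = 1) in absolute value. *)
pose p s x := prob P [% U, S, X] (u, s, x).
have -> : prob P [% U, S] (u, 0) = p 0 0 + p 0 1.
  by rewrite -(sum_prob_joint _ _ _ X) sum_F2.
have -> : prob P [% U, T] (u, 0) = p 0 0 + p 1 1.
  rewrite -(sum_prob_joint _ _ _ X) sum_F2; congr (_ + _); apply: eq_prob => w;
    rewrite !xpair_eqE /T; case: (U w == u) => //=; case: (X w =P _) => [->|]; rewrite ?andbF //.
    by rewrite add0r.
  by case: (S w) => [[|[|]]].
have -> : prob P [% U, X] (u, 1) = p 0 1 + p 1 1.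
  rewrite -(sum_prob_joint _ _ _ S) sum_F2; congr (_ + _); apply: eq_prob => w;
    by rewrite !xpair_eqE andbAC.
have p01 : 0 <= p 0 1 by exact: prob_ge0.
have p11 : 0 <= p 1 1 by exact: prob_ge0.
by rewrite ler_norml; apply/andP; split; lra.
Qed.

End finite_probability.

Arguments neg_entropy {R Omega} P {A} X.
Arguments independent {R Omega} P {A B} X Y.

(** * Linear covering codes *)

Section covering_codes.
Variables n j : nat.
Local Notation word := 'rV['F_2]_n.

Definition hamming_ball : {set word} := [set x | (hamming_weight x <= j)%N]%SET.

(** The code is the row space of [K]; square matrices represent all subspaces by a single type. *)
Definition uncovered (K : 'M['F_2]_n) : {set word} :=
  [set z | [forall (x | x \in hamming_ball), ~~ (z - x <= K)%MS]]%SET.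

Lemma uncoveredP K z : reflect (forall x, x \in hamming_ball -> ~~ (z - x <= K)%MS)
  (z \in uncovered K).
Proof. by rewrite inE; apply: forall_inP. Qed.

Lemma uncovered_adds K v z : z \in uncovered (K + v)%MS ->
  (z \in uncovered K) && (z + v \in uncovered K).
Proof.
move=> /uncoveredP zK; apply/andP; split; apply/uncoveredP => x xB.
  by apply: contra (zK x xB) => /submx_trans; apply; exact: addsmxSl.
apply: contra (zK x xB) => zvK.
have -> : z - x = (z + v - x) - v by rewrite addrAC addrK.
by rewrite addmx_sub_adds // eqmx_opp.
Qed.

(** Averaging over [v]: a word [z] uncovered by [K + v] yields a pair (z, z + v) in [U], so the
    sizes sum to at most [#|U| ^ 2] over the 2^n choices of [v]. *)
Lemma exists_uncovered_adds K :
  exists v : word, (#|uncovered (K + v)%MS| * 2 ^ n <= #|uncovered K| ^ 2)%N.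
Proof.
set U := uncovered K.
case: (pickP (fun v : word => (#|uncovered (K + v)%MS| * 2 ^ n <= #|U| ^ 2)%N)) => [v|no].
  by exists v.
have card_word : #|{: word}| = (2 ^ n)%N by rewrite card_mx card_Fp // mul1n.
have sumU : (\sum_(v : word) #|uncovered (K + v)%MS| <= #|U| ^ 2)%N.
  apply: (@leq_trans (\sum_(v : word) \sum_(z in U) ((z + v)%R \in U))%N).
    apply: leq_sum => v _; rewrite -sum1_card -big_mkcondr.
    rewrite [X in (X <= _)%N]big_mkcond [X in (_ <= X)%N]big_mkcond /=.
    apply: leq_sum => z _; case: ifP => // /uncovered_adds/andP[-> ->] //.
  rewrite exchange_big /= (eq_bigr (fun=> #|U|)) => [|z _].
    by rewrite sum_nat_const mulnn.
  rewrite -big_mkcond /= sum1_card -(card_imset U (addIr (- z))).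
  apply: eq_card => v; apply/idP/imsetP => [zv|[w wU ->]].
    by exists (z + v) => //; rewrite addrAC subrr add0r.
  by rewrite unfold_in /= addrC subrK.
have : (\sum_(v : word) #|U| ^ 2 < \sum_(v : word) #|uncovered (K + v)%MS| * 2 ^ n)%N.
  rewrite [X in (_ < X)%N](bigD1 0) //= [X in (X < _)%N](bigD1 0) //= -addSn leq_add //.
    by rewrite ltnNge no.
  by apply: leq_sum => v _; rewrite ltnW // ltnNge no.
rewrite -!big_distrl /= sum_nat_const card_word -mulnA (mulnC (2 ^ n)%N) mulnn => h.
by have := leq_ltn_trans (leq_mul sumU (leqnn _)) h; rewrite ltnn.
Qed.

(* Goblick's greedy construction: adjoining a random vector to the code squares
   the uncovered fraction on average. *)
Lemma greedy_covering m : exists K : 'M['F_2]_n, (\rank K <= m)%N /\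
  (#|uncovered K| * (2 ^ n) ^ (2 ^ m - 1) <= #|uncovered 0| ^ (2 ^ m))%N.
Proof.
elim: m => [|m [K [rK UK]]].
  by exists 0; rewrite mxrank0 expn0 subnn expn0 muln1 expn1.
have [v Uv] := exists_uncovered_adds K.
exists (K + v)%MS; split.
  apply: leq_trans (mxrank_adds_leqif _ _) _.
  by apply: leq_trans (leq_add rK (rank_leq_row _)) _; rewrite addn1.
have -> : (2 ^ m.+1 - 1 = (2 ^ m - 1) * 2 + 1)%N.
  by rewrite expnSr; have := expn_gt0 2 m; lia.
rewrite expnD expn1 expnM mulnA mulnAC (expnSr 2 m) (expnM _ _ 2).
apply: (@leq_trans ((#|uncovered K| * (2 ^ n) ^ (2 ^ m - 1)) ^ 2)%N); last by rewrite leq_exp2r.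
by rewrite expnMn leq_mul.
Qed.

Lemma uncovered0 : uncovered 0 = (~: hamming_ball)%SET.
Proof.
apply/setP => z; rewrite [RHS]inE; apply/uncoveredP/idP => [h|zB x xB].
  by apply/negP => /h; rewrite subrr sub0mx.
by rewrite submx0 subr_eq0; apply: contra zB => /eqP ->.
Qed.

(** With N = 2^n words and balls of size B, the greedy code leaves at most N (1 - B / N)^(2^m) <= N
    exp(- B 2^m / N) <= (2 / e)^n < 1 words uncovered, hence none. *)
Lemma exists_covering_code (R : realType) m : (0 < n)%N ->
    (n * 2 ^ n <= #|hamming_ball| * 2 ^ m)%N ->
  exists2 K : 'M['F_2]_n, (\rank K <= m)%N &
    forall z : word, exists2 x : word, (hamming_weight x <= j)%N & (z - x <= K)%MS.
Proof.
move=> n0 hB; have [K [rK UK]] := greedy_covering m.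
exists K => // z; set B := #|hamming_ball| in hB.
have card_word : #|{: word}| = (2 ^ n)%N by rewrite card_mx card_Fp // mul1n.
have BN : (B <= 2 ^ n)%N by rewrite -card_word max_card.
have U0E : #|uncovered 0| = (2 ^ n - B)%N by rewrite uncovered0 -card_word -(cardsC hamming_ball) addKn.
suff UK0 : #|uncovered K| = 0%N.
  have : z \notin uncovered K by move/eqP: UK0; rewrite cards_eq0 => /eqP ->; rewrite inE.
  rewrite inE negb_forall_in => /exists_inP[x xB]; rewrite negbK => zx.
  by exists x => //; move: xB; rewrite inE.
apply/eqP; rewrite -leqn0 -ltnS -(@ltr_nat R).
have N0 : (0 : R) < (2 ^ n)%:R by rewrite ltr0n expn_gt0.
have M0 : (0 < 2 ^ m)%N by rewrite expn_gt0.
set N : R := (2 ^ n)%:R in N0.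
rewrite -(@ltr_pM2r _ (N ^+ (2 ^ m - 1))) ?exprn_gt0 // mul1r.
apply: (@le_lt_trans _ _ (#|uncovered 0|%:R ^+ (2 ^ m))).
  by rewrite /N -!natrX -natrM ler_nat.
rewrite U0E natrB // -/N.
have -> : N - B%:R = N * (1 - B%:R / N) by rewrite mulrBr mulr1 mulrCA divff ?mulr1 // gt_eqF.
rewrite exprMn -[X in N ^+ X * _](subnK M0) exprD expr1 -mulrA gtr_pMr ?exprn_gt0 //.
have h0 : 0 <= 1 - B%:R / N by rewrite subr_ge0 ler_pdivrMr // mul1r ler_nat.
apply: (@le_lt_trans _ _ (N * expR (- (B%:R / N)) ^+ (2 ^ m))).
  rewrite ler_pM2l // lerXn2r ?nnegrE ?expR_ge0 //; exact: expR_ge1Dx.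
apply: (@le_lt_trans _ _ (N * expR (- n%:R))).
  rewrite ler_pM2l // -expRM_natl ler_expR mulrN lerN2 mulrA ler_pdivlMr //.
  by rewrite /N -!natrM ler_nat [X in (_ <= X)%N]mulnC.
rewrite expRN ltr_pdivrMr ?expR_gt0 // mul1r /N natrX -[n%:R]mulr1 expRM_natl.
by rewrite ltrXn2r ?nnegrE // ?expR_ge0 -?lt0n //; have := @expR_gt1Dx R 1; rewrite oner_eq0 => /(_ isT).
Qed.

Lemma leq_bin_hamming_ball : ('C(n, j) <= #|hamming_ball|)%N.
Proof.
rewrite -[n in 'C(n, _)]card_ord -card_draws.
pose f (A : {set 'I_n}) : word := \row_i (i \in A)%:R.
have fE A i : (f A 0 i != 0) = (i \in A) by rewrite mxE; case: (i \in A).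
have f_inj : injective f.
  by move=> A A' /rowP ff; apply/setP => i; rewrite -!fE ff.
rewrite -(card_imset _ f_inj) subset_leq_card //.
apply/fintype.subsetP => _ /imsetP[A + ->]; rewrite !inE => /eqP <-.
by rewrite /hamming_weight; apply/eq_leq/eq_card => i; rewrite inE fE.
Qed.

End covering_codes.

(* The term of index [j] is the largest one in the expansion of [((n - j) + j) ^ n]. *)
Lemma leq_expnn_bin n j : (j <= n)%N ->
  (n ^ n <= n.+1 * ('C(n, j) * (n - j) ^ (n - j) * j ^ j))%N.
Proof.
move=> jn; pose T i := ('C(n, i) * (n - j) ^ (n - i) * j ^ i)%N.
have binS i : (i < n)%N -> (i.+1 * 'C(n, i.+1) = (n - i) * 'C(n, i))%N.
  by move=> _; rewrite mul_bin_left.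
(* [TS] and [T0] expose a common factor, so comparing consecutive terms reduces to (n - i) j against
   (i + 1) (n - j), whose order flips at i = j. *)
have TS i : (i < n)%N -> (i.+1 * T i.+1 =
    (n - i) * j * ('C(n, i) * (n - j) ^ (n - i.+1) * j ^ i))%N.
  by move=> hi; rewrite /T expnS !mulnA binS //; nia.
have T0 i : (i < n)%N -> (i.+1 * T i =
    i.+1 * (n - j) * ('C(n, i) * (n - j) ^ (n - i.+1) * j ^ i))%N.
  by move=> hi; rewrite /T subnS -[(n - i)%N in LHS]prednK ?subn_gt0 // expnS; nia.
have up i : (i < j)%N -> (T i <= T i.+1)%N.
  move=> ij; have hi : (i < n)%N by exact: leq_trans jn.
  rewrite -(@leq_pmul2l i.+1) // TS // T0 // leq_mul2r; apply/orP; right; nia.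
have down i : (j <= i < n)%N -> (T i.+1 <= T i)%N.
  move=> /andP[ji hi].
  rewrite -(@leq_pmul2l i.+1) // TS // T0 // leq_mul2r; apply/orP; right; nia.
have upT d : (d <= j)%N -> (T (j - d) <= T j)%N.
  elim: d => [|d IH] dj; first by rewrite subn0.
  by apply: leq_trans (IH (ltnW dj)); rewrite -[(j - d)%N](@subnSK d j) // up // subnSK // leq_subr.
have downT d : (j + d <= n)%N -> (T (j + d) <= T j)%N.
  elim: d => [|d IH] dj; first by rewrite addn0.
  rewrite addnS in dj *; apply: leq_trans (IH (ltnW dj)).
  by rewrite down // leq_addr dj.
rewrite -{1}(subnK jn) expnDn -[X in (_ <= X * _)%N]card_ord -sum_nat_const.
apply: leq_sum => i _; rewrite -/(T j) mulnA -/(T i).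
have iln : (i <= n)%N by rewrite -ltnS.
case: (leqP i j) => [ij|/ltnW ji].
  by rewrite -(subKn ij) upT // leq_subr.
by rewrite -(subnKC ji) downT // subnKC.
Qed.

(** * Coset coding *)

(** The rows are the first [k] vectors of a basis of a complement of [K], which meets [K] only in
    0. *)
Lemma exists_transversal_rows (F : fieldType) n k (K : 'M[F]_n) :
  (k + \rank K <= n)%N ->
  exists G : 'M[F]_(k, n), forall u : 'rV_k, (u *m G <= K)%MS -> u = 0.
Proof.
move=> kn; exists (pid_mx k *m row_base (K^C)%MS) => u uK.
have kr : (k <= \rank (K^C)%MS)%N by rewrite mxrank_compl; lia.
have : (u *m (pid_mx k *m row_base (K^C)%MS) <= (K :&: K^C)%MS)%MS.
  by rewrite sub_capmx uK /= mulmxA (submx_trans (submxMl _ _)) // eq_row_base.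
rewrite capmx_compl submx0 mulmxA => /eqP uG0.
have {}uG0 : u *m @pid_mx F k (\rank (K^C)%MS) k = 0.
  apply: (@row_free_inj F 1 _ _ (row_base (K^C)%MS) (row_base_free _)).
  by rewrite /= uG0 mul0mx.
by rewrite -[u]mulmx1 -(@pid_mx_1 F k) -(@pid_mx_id F k (\rank (K^C)%MS) k k kr) mulmxA uG0 mul0mx.
Qed.

Section coset_code.
Variables (R : realType) (q : R).

(* User [i] sends a word [x_i] of weight at most [j] with [x_i = v_i + s_i] modulo [K], so
   that the interference cancels in [x_1 + s_1 + x_2 + s_2 = v_1 + v_2] modulo [K]; [v_1]
   and [v_2] range over complementary subspaces that are independent from [K]. *)
Lemma exists_errorfree_code n j k1 k2 m : 0 <= q ->
    j%:R <= n%:R * q -> (k1 + k2 + m <= n)%N ->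
    (exists2 K : 'M['F_2]_n, (\rank K <= m)%N & forall z : 'rV['F_2]_n,
      exists2 x : 'rV_n, (hamming_weight x <= j)%N & (z - x <= K)%MS) ->
  exists c : block_code q n, [/\ rate1 c = k1%:R / n%:R, rate2 c = k2%:R / n%:R &
    error_probability c = 0].
Proof.
move=> q0 jq kn [K rK cov].
have [|G GK] := @exists_transversal_rows _ n (k1 + k2) K; first by lia.
have [f fP] : exists f : 'rV['F_2]_n -> 'rV['F_2]_n,
    forall z, (hamming_weight (f z) <= j)%N /\ (z - f z <= K)%MS.
  have /choice[f fP] : forall z : 'rV['F_2]_n, exists x, (hamming_weight x <= j)%N /\ (z - x <= K)%MS.
    by move=> z; have [x xj zx] := cov z; exists x.
  by exists f.
have wf z : (hamming_weight (f z))%:R / n%:R <= q.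
  have [->|n0] := eqVneq n%:R (0 : R); first by rewrite invr0 mulr0.
  rewrite ler_pdivrMr; last by rewrite lt_neqAle eq_sym n0 ler0n.
  by rewrite mulrC (le_trans _ jq) // ler_nat; case: (fP z).
pose v (w : 'rV['F_2]_k1 * 'rV['F_2]_k2) := row_mx w.1 w.2 *m G.
have v_inj w w' : (v w - v w' <= K)%MS -> w = w'.
  rewrite /v -mulmxBl => /GK/eqP; rewrite subr_eq0 => /eqP/eq_row_mx[].
  by case: w w' => [? ?] [? ?] /= -> ->.
have msg_gt0 k : (0 < #|'rV['F_2]_k|)%N by rewrite card_mx card_Fp // expn_gt0.
pose d y := odflt (0, 0) [pick w | (y - v w <= K)%MS].
pose c := @BlockCode R q n 'rV['F_2]_k1 'rV['F_2]_k2 (msg_gt0 _) (msg_gt0 _)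
  (fun w s => f (v (w, 0) + s)) (fun w s => f (v (0, w) + s))
  (fun _ _ => wf _) (fun _ _ => wf _) d.
have rateE k : log2 #|'rV['F_2]_k|%:R / n%:R = k%:R / n%:R :> R.
  rewrite card_mx card_Fp // mul1n /log2 natrX lnXn ?ltr0n // -[X in X / ln _]mulr_natl mulfK //.
  by rewrite gt_eqF // ln_gt0 // ltr1n.
exists c; split; [exact: rateE|exact: rateE|].
rewrite /error_probability big1 // => w _; rewrite big1 // => s1 _; rewrite big1 // => s2 _.
suff -> : dec c (channel_output w s1 s2) = w by rewrite eqxx mulr0.
rewrite /= /d /channel_output /=; set y := _ + _ + s1 + s2.
have oppK (s : 'rV['F_2]_n) : s = - s.
  by apply/rowP => i; rewrite !mxE; case: (s 0 i) => [[|[]]] //= ?; exact/val_inj.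
have yv : (y - v w <= K)%MS.
  have -> : y - v w = - (v (w.1, 0) + s1 - f (v (w.1, 0) + s1))
                      - (v (0, w.2) + s2 - f (v (0, w.2) + s2)).
    rewrite /y [v w]/v; have -> : row_mx w.1 w.2 = row_mx w.1 0 + row_mx 0 w.2.
      by rewrite add_row_mx addr0 add0r.
    rewrite mulmxDl -/(v (w.1, 0)) -/(v (0, w.2)).
    (* Flipping the signs of [s1] and [s2], harmless in characteristic 2, exhibits [y - v w] as
       minus the sum of the two covering errors, both in [K]. *)
    rewrite [X in _ + X + s2]oppK [X in _ + X - (_ + _)]oppK.
    by apply/rowP => i; rewrite !mxE; ring.
  by rewrite addmx_sub // eqmx_opp; case: (fP (v (w.1, 0) + s1)); case: (fP (v (0, w.2) + s2)).
case: pickP => [w' yv'|/(_ w)]; last by rewrite yv.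
apply: v_inj.
have -> : v w' - v w = (y - v w) - (y - v w') by rewrite opprB [RHS]addrC addrA subrK.
by rewrite addmx_sub // eqmx_opp.
Qed.

(** One message per user, the zero word always sent, and the whole space as [K]. This serves the
    lengths with no good code and the case q = 0. *)
Lemma exists_trivial_code n : 0 <= q -> exists c : block_code q n,
  [/\ rate1 c = 0, rate2 c = 0 & error_probability c = 0].
Proof.
move=> q0; have nq : 0%:R <= n%:R * q by rewrite mulr_ge0.
have [|c [r1 r2 ec]] := exists_errorfree_code n 0 0 0 n q0 nq (leqnn n).
  exists 1%:M; first exact: rank_leq_row.
  move=> z; exists 0; last by rewrite submx1.
  by rewrite /hamming_weight leqn0 cards_eq0; apply/eqP/setP => i; rewrite !inE mxE eqxx.
by exists c; rewrite r1 r2 mul0r.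
Qed.

End coset_code.

(** * Achievable rates below the binary entropy *)

Lemma near_ln_le (R : realType) (C d : R) : 0 < d ->
  \forall n \near \oo, 2 * ln (n.+1%:R) + C <= n%:R * d.
Proof.
(* With y = sqrt (n + 1), 2 ln (n + 1) is below 4 y and n = y^2 - 1; once y >= Y, y^2 d dominates (4
   + |C| + d) y. *)
move=> d0; pose Y := (4 + `|C| + d) / d.
have Y1 : 1 <= Y by rewrite ler_pdivlMr // mul1r; have := normr_ge0 C; lra.
near=> n.
pose y : R := Num.sqrt n.+1%:R.
have n1 : (0 : R) <= n.+1%:R by [].
have yy : y ^+ 2 = n.+1%:R by rewrite sqr_sqrtr.
have y0 : 0 < y by rewrite sqrtr_gt0 ltr0n.
have Yy : Y <= y.
  have Y0 : 0 <= Y by lra.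
  rewrite -(ger0_norm Y0) -sqrtr_sqr ler_sqrt //.
  apply: (@le_trans _ _ n%:R); last by rewrite ler_nat.
  by near: n; exact: nbhs_infty_ger.
have lny : ln n.+1%:R = 2 * ln y :> R by rewrite -yy lnXn // mulr_natl.
have := ln_sublinear y0.
have dY : 4 + `|C| + d = Y * d by rewrite divfK // gt_eqF.
have nE : n%:R = y ^+ 2 - 1 :> R by rewrite yy -natr1 addrK.
rewrite lny nE.
have h1 : y * (4 + `|C| + d) <= y ^+ 2 * d.
  by rewrite dY expr2 -mulrA ler_wpM2l ?(ltW y0) // ler_wpM2r // ltW.
have := ler_norm C.
have h2 : `|C| + d <= y * (`|C| + d).
  by rewrite ler_peMl ?(le_trans Y1) // addr_ge0 // ltW.
rewrite mulrBl mul1r; lra.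
Unshelve. all: by end_near. Qed.

Lemma bin_entropy_ge0 (R : realType) (x : R) : 0 <= x <= 1 -> 0 <= bin_entropy x.
Proof.
move=> /andP[x0 x1]; rewrite oppr_ge0 -[leRHS]addr0 lerD // /xlnx mulr_ge0_le0 ?subr_ge0 //;
  apply: ln_le0; lra.
Qed.

Section achievability.
Variables (R : realType) (q : R).
Hypothesis q01 : 0 < q <= 1.

(** With j the floor of n q, the largest-term bound gives ln C(n, j) >= n h(j / n) - ln (n + 1). The
    chord bound gives n h(j / n) >= j h(q) / q, and since j > n q - 1 this loses at most h(q) / q.
    The second logarithm pays for the factor [n]. *)
Lemma covering_condition n k : (0 < n)%N ->
    2 * ln n.+1%:R + k%:R * ln 2 + bin_entropy q / q <= n%:R * bin_entropy q ->
  (n * 2 ^ k <= 'C(n, Num.truncn (n%:R * q)))%N.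
Proof.
move=> n0; have [q0 q1] := andP q01; set j := Num.truncn _ => hk.
have nq0 : 0 <= n%:R * q by rewrite mulr_ge0 // ltW.
have /andP[jnq nqj] := truncn_itv nq0; rewrite -/j in jnq nqj.
have n0' : 0 < n%:R :> R by rewrite ltr0n.
have jn : (j <= n)%N.
  by rewrite -(@ler_nat R) (le_trans jnq) // ger_pMr.
have XX m : (0 < m ^ m)%N by rewrite expn_gt0; case: m.
have lnXX m : ln (m ^ m)%:R = xlnx m%:R.
  case: m => [|m]; first by rewrite expn0 ln1 xlnx0.
  by rewrite natrX lnXn ?ltr0n // /xlnx mulr_natl.
pose X := ((n - j) ^ (n - j) * j ^ j)%N.
have X0 : (0 < X)%N by rewrite muln_gt0 !XX.
suff : (n * 2 ^ k * (n.+1 * X) <= n ^ n)%N.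
  move=> h; have := leq_trans h (leq_expnn_bin n j jn).
  by rewrite -[('C(n, j) * _ * _)%N]mulnA -/X (mulnCA (n * 2 ^ k)%N) leq_pmul2l // leq_pmul2r.
have P2 : (0 < 2 ^ k)%N by rewrite expn_gt0.
rewrite -(ler_nat R) -ler_ln ?posrE ?ltr0n ?XX ?muln_gt0 ?n0 ?P2 ?XX //.
rewrite !natrM !lnM ?posrE ?mulr_gt0 ?ltr0n ?P2 ?XX //.
rewrite natrX lnXn // !lnXX -[ln 2 *+ k]mulr_natl.
have jR : 0 <= j%:R :> R by [].
have njR : 0 <= (n - j)%:R :> R by [].
have jnn : j%:R + (n - j)%:R = n%:R :> R by rewrite -natrD subnKC.
have := split_entropy R _ _ _ n0' jR njR jnn; rewrite (addrC (xlnx (n - j)%:R)) => ->.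
have lnn : ln n%:R <= ln n.+1%:R :> R by rewrite ler_ln ?posrE ?ltr0n // ler_nat.
have jnE : j%:R / n%:R = (j%:R / (n%:R * q)) * q :> R.
  by rewrite invfM mulrA -mulrA mulVf ?mulr1 // gt_eqF.
have nq0' : 0 < n%:R * q by rewrite mulr_gt0.
have l01 : 0 <= j%:R / (n%:R * q) <= 1.
  by rewrite divr_ge0 //= ler_pdivrMr // mul1r.
have q01' : 0 <= q <= 1 by rewrite q1 ltW.
have := bin_entropy_chord R _ _ l01 q01'; rewrite -jnE => /(ler_wpM2l (ltW n0')).
have H0 := bin_entropy_ge0 R q q01'.
have -> : n%:R * (j%:R / (n%:R * q) * bin_entropy q) = j%:R * (bin_entropy q / q).
  by field; rewrite !gt_eqF.
have : (n%:R * q - 1) * (bin_entropy q / q) <= j%:R * (bin_entropy q / q).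
  by rewrite ler_wpM2r // ?divr_ge0 ?(ltW q0) // lerBlDr natr1 ltW.
have -> : (n%:R * q - 1) * (bin_entropy q / q) = n%:R * bin_entropy q - bin_entropy q / q.
  by field; rewrite !gt_eqF.
lra.
Qed.

Lemma exists_rate_code n k1 k2 : (0 < n)%N ->
    2 * ln n.+1%:R + (k1 + k2)%:R * ln 2 + bin_entropy q / q <= n%:R * bin_entropy q ->
  exists c : block_code q n, [/\ rate1 c = k1%:R / n%:R, rate2 c = k2%:R / n%:R &
    error_probability c = 0].
Proof.
move=> n0 /covering_condition-/(_ n0); set j := Num.truncn _ => hk.
have q0 : 0 <= q by case/andP: q01 => /ltW.
have hB := leq_trans hk (leq_bin_hamming_ball n j).
have kn : (k1 + k2 <= n)%N.
  rewrite -(leq_exp2l _ _ (ltnSn 1)).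
  apply: (@leq_trans (n * 2 ^ (k1 + k2))%N); first by rewrite leq_pmull.
  by rewrite (leq_trans hB) // (leq_trans (max_card _)) // card_mx card_Fp // mul1n.
apply: (exists_errorfree_code _ _ n j k1 k2 (n - (k1 + k2))) => //.
- by rewrite truncn_le mulr_ge0.
(* The choice [m = n - (k1 + k2)] lets the message bits fill exactly the codimension allowed for
   [K]. *)
- by rewrite subnKC.
apply: (exists_covering_code n j R) => //.
by rewrite -{2}(subnKC kn) expnD mulnA leq_mul2r hB orbT.
Qed.

(** User i gets floor (n r_i) bits; the gap in the strict inequality, times n, eventually absorbs
    the logarithmic and constant losses. *)
Lemma achievable_lt_entropy (r1 r2 : R) : 0 <= r1 -> 0 <= r2 ->
  (r1 + r2) * ln 2 < bin_entropy q -> achievable q (r1, r2).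
Proof.
move=> r10 r20 hr; split => //=.
pose k r n := Num.truncn (n%:R * r : R).
pose good n (c : block_code q n) := [/\ rate1 c = (k r1 n)%:R / n%:R,
  rate2 c = (k r2 n)%:R / n%:R & error_probability c = 0].
have near_good : \forall n \near \oo, exists c, good n c.
  have d0 : 0 < bin_entropy q - (r1 + r2) * ln 2 by rewrite subr_gt0.
  near=> n; apply: exists_rate_code; first by near: n; exists 1%N.
  have : 2 * ln (n.+1%:R) + bin_entropy q / q <= n%:R * (bin_entropy q - (r1 + r2) * ln 2).
    by near: n; exact: near_ln_le.
  have l2 : 0 <= ln 2 :> R by rewrite ln_ge0 // ler1n.
  have : (k r1 n + k r2 n)%:R * ln 2 <= n%:R * (r1 + r2) * ln 2.
    by rewrite ler_wpM2r // natrD mulrDr lerD // /k truncn_le mulr_ge0.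
  lra.
(* A code is needed at every length: a good one where it exists, the trivial one elsewhere. *)
have [c cP] : exists c : forall n, block_code q n,
    forall n, (exists c, good n c) -> good n (c n).
  suff h n : exists c, (exists c, good n c) -> good n c.
    by exists (fun n => projT1 (cid (h n))) => n; case: (cid (h n)).
  have [[c gc]|no] := pselect (exists c, good n c); first by exists c.
  by have [c _] := exists_trivial_code _ _ n (ltW (andP q01).1); exists c => /no.
exists c.
have lim r (u : nat -> R) : 0 <= r -> (\forall n \near \oo, u n = (k r n)%:R / n%:R) ->
    u n @[n --> \oo] --> r.
  move=> r0 uE; apply/cvgrPdist_le => e e0; near=> n.
  have n0 : 0 < n%:R :> R by rewrite ltr0n; near: n; exists 1%N.
  have -> : u n = (k r n)%:R / n%:R by near: n.
  have nr0 : 0 <= n%:R * r by rewrite mulr_ge0 // ltW.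
  have /andP[kn nk] := truncn_itv nr0; rewrite -/(k r n) in kn nk.
  have -> : r - (k r n)%:R / n%:R = (n%:R * r - (k r n)%:R) / n%:R.
    by field; rewrite gt_eqF.
  rewrite ger0_norm ?divr_ge0 ?subr_ge0 ?(ltW n0) // ler_pdivrMr //.
  have : 1 / e <= n%:R by near: n; exact: nbhs_infty_ger.
  rewrite ler_pdivrMr // => h; rewrite (mulrC e); apply: le_trans h.
  by rewrite lerBlDr addrC natr1 ltW.
split.
- by apply: lim => //; near=> n; case: (cP n) => //; near: n.
- by apply: lim => //; near=> n; case: (cP n) => //; near: n.
- apply/cvgrPdist_le => e e0; near=> n.
  have [] : good n (c n) by apply: cP; near: n.
  by move=> _ _ ->; rewrite subrr normr0 ltW.
Unshelve. all: by end_near. Qed.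

End achievability.

(** * The single-letter region *)

Section single_letter_outer_bound.
Variable R : realType.

Lemma fair_bitE b : fair_bit R b = 2^-1.
Proof.
rewrite /fair_bit /bernoulli_pmf; case: ifP => // _; lra.
Qed.

Section one_test_channel.
Variable t : test_channel R.
Local Notation P := (law t).

Lemma prob_S1 s : prob P (@S1 _ t) s = 2^-1.
Proof.
by rewrite -(sum_prob_joint _ _ _ _ _ _ (@S2 _ t)) sum_F2 !S1S2_law !fair_bitE; lra.
Qed.

Lemma prob_S2 s : prob P (@S2 _ t) s = 2^-1.
Proof.
rewrite -(sum_prob_joint _ _ _ _ _ _ (@S1 _ t)) sum_F2 !(prob_jointC _ _ _ _ _ (@S2 _ t)).
by rewrite !S1S2_law !fair_bitE; lra.
Qed.

(** The conditional factorization is multiplied by the probabilities 1/4 and 1/2 of the interference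
    values, all positive. *)
Lemma independent_users :
  independent P [% @U1 _ t, @X1 _ t, @S1 _ t] [% @U2 _ t, @X2 _ t, @S2 _ t].
Proof.
move=> [[u1 x1] s1] [[u2 x2] s2].
have := UX_law u1 u2 x1 x2 s1 s2.
rewrite /cond_prob S1S2_law prob_S1 prob_S2 !fair_bitE !invrK => h.
rewrite -[LHS](eq_prob _ _ _ _ _ [% [% @U1 _ t, @U2 _ t, @X1 _ t, @X2 _ t], [% @S1 _ t, @S2 _ t]]
  _ (u1, u2, x1, x2, (s1, s2))).
  by move: h; rewrite invfM !invrK; lra.
by move=> w; rewrite !xpair_eqE; do !case: eqP.
Qed.

Lemma sum_rate_le (rho c q : R) (r : R^o * R^o) : 0 < rho <= 1 -> 0 <= c ->
    2 * ln (1 + rho) - ln 2 <= c ->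
    mean_bit P (@X1 _ t) <= q -> mean_bit P (@X2 _ t) <= q -> pentagon t r ->
  (r.1 + r.2) * ln 2 <= c - 2 * ln rho * q.
Proof.
move=> hr c0 hc m1 m2 [_ _ _ hsum].
have l2 : 0 <= ln 2 :> R by rewrite ln_ge0 // ler1n.
apply: le_trans (ler_wpM2r l2 hsum) _; rewrite !mulrBl !mutual_infoE.
pose T1 w := @X1 _ t w + @S1 _ t w; pose T2 w := @X2 _ t w + @S2 _ t w.
have indT : independent P [% @U1 _ t, T1] [% @U2 _ t, T2].
  exact: (independent_comp _ _ _ _ _ _ _ _ _ (fun a => (a.1.1, a.1.2 + a.2))
    (fun a => (a.1.1, a.1.2 + a.2)) independent_users).
have indU : independent P (@U1 _ t) (@U2 _ t).
  exact: (independent_comp _ _ _ _ _ _ _ _ _ (fun a => a.1.1) (fun a => a.1.1) independent_users).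
have indT' : independent P [% @U2 _ t, T2] [% @U1 _ t, T1].
  by move=> a b; rewrite prob_jointC indT mulrC.
(* [h1] and [h2] bound H(Y | U1, U2) below by H(T1 | U1) and by H(T2 | U2); half of each is combined
   with half of [g1] and of [g2]. *)
have h1 := neg_entropy_sum_le _ _ _ _ _ _ _ _ _ indT.
have h2 := neg_entropy_sum_le _ _ _ _ _ _ _ _ _ indT'.
have g1 := dirty_entropy_gap _ _ P _ (@U1 _ t) (@X1 _ t) (@S1 _ t) rho c hr c0 hc.
have g2 := dirty_entropy_gap _ _ P _ (@U2 _ t) (@X2 _ t) (@S2 _ t) rho c hr c0 hc.
rewrite -/T1 in g1; rewrite -/T2 in g2.
have hY := neg_entropy_bit _ _ P (@output _ t).
rewrite (neg_entropy_independent _ _ _ _ _ _ _ indU).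
rewrite (neg_entropy_fair_bit _ _ _ (@S1 _ t) prob_S1) (neg_entropy_fair_bit _ _ _ (@S2 _ t) prob_S2).
have outE : @output _ t = (fun w => T1 w + T2 w).
  by apply/funext => w; rewrite /output /T1 /T2; ring.
have e1 : neg_entropy P [% @U1 _ t, @U2 _ t, @output _ t] =
    neg_entropy P [% @U1 _ t, @U2 _ t, fun w => T1 w + T2 w] by rewrite outE.
have e2 : neg_entropy P [% @U1 _ t, @U2 _ t, @output _ t] =
    neg_entropy P [% @U2 _ t, @U1 _ t, fun w => T2 w + T1 w].
  rewrite e1 /neg_entropy.
  rewrite (reindex (fun p : aux2 t * aux1 t * 'F_2 => (p.1.2, p.1.1, p.2))) /=; last first.
    by exists (fun p => (p.1.2, p.1.1, p.2)) => -[[]].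
  apply: eq_bigr => -[[u2 u1] y] _; congr (xlnx _); apply: eq_prob => w.
  by rewrite !xpair_eqE /= addrC; congr (_ && _); rewrite andbC.
have lr : ln rho <= 0 by apply: ln_le0; case/andP: hr.
have b1 : 0 <= - ln rho * (q - mean_bit P (@X1 _ t)) by rewrite mulr_ge0 ?oppr_ge0 // subr_ge0.
have b2 : 0 <= - ln rho * (q - mean_bit P (@X2 _ t)) by rewrite mulr_ge0 ?oppr_ge0 // subr_ge0.
lra.
Qed.

End one_test_channel.

(** [K] is in nats. The same shape serves as outer bound for [R_BSL] and as inner bound for the
    capacity region. *)
Definition rate_triangle (K : R) : set (R^o * R^o) :=
  [set r | [/\ 0 <= r.1, 0 <= r.2 & (r.1 + r.2) * ln 2 <= K]].

Lemma closed_rate_triangle K : closed (rate_triangle K).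
Proof.
have fc : continuous (fst : R^o * R^o -> R^o) by move=> x; exact: cvg_fst.
have sc : continuous (snd : R^o * R^o -> R^o) by move=> x; exact: cvg_snd.
have -> : rate_triangle K = (fst @^-1` [set x : R^o | 0 <= x]) `&` ((snd @^-1` [set x : R^o | 0 <= x])
    `&` ((fun r : R^o * R^o => (r.1 + r.2) * ln 2 : R^o) @^-1` [set x : R^o | x <= K])).
  by apply/seteqP; split => r /=; [case|case=> ? []].
apply: closedI; first by apply: preimage_closed; [move=> x _; exact: fc|exact: closed_ge].
apply: closedI; first by apply: preimage_closed; [move=> x _; exact: sc|exact: closed_ge].
apply: preimage_closed; last exact: closed_le.
by move=> x _; apply: cvgMl; apply: cvgD; [exact: fc|exact: sc].
Qed.

Lemma convex_rate_triangle K :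
  convex_set (rate_triangle K : set (convex_lmodType (R^o * R^o)%type)).
Proof.
move=> x y l; rewrite !inE => -[x1 x2 xK] [y1 y2 yK].
have l0 : 0 <= l%:num by [].
have l1 : 0 <= 1 - l%:num by rewrite subr_ge0.
split => /=.
- by rewrite addr_ge0 // mulr_ge0.
- by rewrite addr_ge0 // mulr_ge0.
have := ler_wpM2l l0 xK; have := ler_wpM2l l1 yK.
rewrite /unstable.onem /GRing.scale /=; lra.
Qed.

Lemma R_BSL_sub_triangle (rho c q : R) : 0 < rho <= 1 -> 0 <= c ->
    2 * ln (1 + rho) - ln 2 <= c ->
  R_BSL q `<=` rate_triangle (c - 2 * ln rho * q).
Proof.
move=> hr c0 hc; rewrite /R_BSL closureE.
apply: smallest_sub; first exact: closed_rate_triangle.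
apply: smallest_sub; first exact: convex_rate_triangle.
move=> r /= [t [m1 m2 pr]]; case: (pr) => -[r1 r2] _ _ _; split => //.
exact: sum_rate_le pr.
Qed.

(** The choice rho^2 = q / (1 - q) gives h(q) = - ln (1 - q) - 2 q ln rho, leaving c <= - ln (1 -
    q), that is (1 + rho)^2 (1 - q) <= 2. The difference of the two sides is (rho - 1)^2 (1 - q),
    which vanishes only at rho = 1, that is q = 1/2. *)
Lemma single_letter_sum_rate_gap (q : R) : 0 < q <= 2^-1 ->
  exists rho c : R, [/\ 0 < rho <= 1, 0 <= c, 2 * ln (1 + rho) - ln 2 <= c,
    c - 2 * ln rho * q <= bin_entropy q &
    q < 2^-1 -> c - 2 * ln rho * q < bin_entropy q].
Proof.
move=> /andP[q0 q2].
have q1 : 0 < 1 - q by lra.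
pose rho := Num.sqrt (q / (1 - q)).
have d0 : 0 < q / (1 - q) by rewrite divr_gt0.
have r0 : 0 < rho by rewrite sqrtr_gt0.
have rr : rho ^+ 2 = q / (1 - q) by rewrite sqr_sqrtr // ltW.
have d1 : q / (1 - q) <= 1 by rewrite ler_pdivrMr // mul1r; lra.
have r1 : rho <= 1 by rewrite -sqrtr1 ler_sqrt.
have lrr : 2 * ln rho = ln q - ln (1 - q) by rewrite mulr_natl -lnXn // rr ln_div ?posrE.
have HE : bin_entropy q = - ln (1 - q) - 2 * ln rho * q.
  by rewrite lrr /bin_entropy /xlnx; ring.
have rq : rho ^+ 2 * (1 - q) = q by rewrite rr divfK // gt_eqF.
have sE : 2 * ln (1 + rho) + ln (1 - q) = ln (1 + 2 * (rho * (1 - q))).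
  have s0 : 0 < 1 + rho by lra.
  rewrite mulr_natl -lnXn // -lnM ?posrE ?exprn_gt0 //; congr ln.
  transitivity ((1 - q) + 2 * (rho * (1 - q)) + rho ^+ 2 * (1 - q)); first by ring.
  by rewrite rq; ring.
have p0 : 0 < rho * (1 - q) by rewrite mulr_gt0.
have l1q : ln (1 - q) < 0 by rewrite ln_lt0 // q1 /=; lra.
pose m := Num.max 0 (2 * ln (1 + rho) - ln 2).
exists rho, m; split; rewrite ?r0 //.
- by rewrite le_max lexx.
- by rewrite le_max lexx orbT.
- rewrite HE lerD2r ge_max oppr_ge0 (ltW l1q) /=.
  have : ln (1 + 2 * (rho * (1 - q))) <= ln 2.
    rewrite ler_ln ?posrE //; last by lra.
    have : 0 <= (rho - 1) ^+ 2 * (1 - q) by rewrite mulr_ge0 ?sqr_ge0 // ltW.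
    have -> : (rho - 1) ^+ 2 * (1 - q) = rho ^+ 2 * (1 - q) - 2 * (rho * (1 - q)) + (1 - q) by ring.
    rewrite rq; lra.
  by rewrite -sE; lra.
- move=> q12; rewrite HE ltrD2r gt_max oppr_gt0 l1q /=.
  have : ln (1 + 2 * (rho * (1 - q))) < ln 2.
    rewrite ltr_ln ?posrE //; last by lra.
    have rn : rho - 1 != 0.
      rewrite subr_eq0; apply/eqP => r11; move: rq; rewrite r11; lra.
    have : 0 < (rho - 1) ^+ 2 * (1 - q) by rewrite mulr_gt0 // exprn_even_gt0.
    have -> : (rho - 1) ^+ 2 * (1 - q) = rho ^+ 2 * (1 - q) - 2 * (rho * (1 - q)) + (1 - q) by ring.
    rewrite rq; lra.
  by rewrite -sE; lra.
Qed.

End single_letter_outer_bound.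

(** * Comparison of the two regions *)

Arguments rate_triangle {R} K.

(** Pairs on the edge of sum rate h(q) are limits of shrunken copies strictly inside, which are
    achievable; h(q) > 0 covers the origin. *)
Lemma triangle_sub_capacity (R : realType) (q : R) : 0 < q <= 2^-1 ->
  rate_triangle (bin_entropy q) `<=` capacity_region q.
Proof.
move=> /andP[q0 q2] r [r1 r2 hr].
have l2 : 0 < ln 2 :> R by rewrite ln_gt0 // ltr1n.
have q1 : q < 1 by lra.
have H0 : 0 < bin_entropy q.
  have l : ln q < 0 by rewrite ln_lt0 // q0.
  have l' : ln (1 - q) < 0 by rewrite ln_lt0 //; apply/andP; split; lra.
  rewrite /bin_entropy /xlnx.
  have : 0 < q * - ln q by rewrite mulr_gt0 // oppr_gt0.
  have : 0 < (1 - q) * - ln (1 - q) by rewrite mulr_gt0 ?oppr_gt0 // subr_gt0.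
  lra.
pose u (n : nat) : R^o * R^o := ((1 - harmonic n) * r.1, (1 - harmonic n) * r.2).
apply: (@closed_cvg nat _ \oo _ u (closure (achievable q)) (@closed_closure _ _) _ r).
- near=> n; apply: subset_closure; apply: achievable_lt_entropy.
  + by rewrite q0 ltW.
  + by rewrite mulr_ge0 // subr_ge0 invf_le1 ?ltr0n // ler1n.
  + by rewrite mulr_ge0 // subr_ge0 invf_le1 ?ltr0n // ler1n.
  + rewrite -mulrDr -mulrA.
    have h0 : 0 < harmonic n :> R by rewrite harmonic_gt0.
    have [s0|s0] := eqVneq ((r.1 + r.2) * ln 2) 0; first by rewrite s0 mulr0.
    apply: lt_le_trans hr; rewrite gtr_pMl; first lra.
    by rewrite lt_neqAle eq_sym s0 mulr_ge0 ?addr_ge0 // ltW.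
- have lim (x : R^o) : (1 - harmonic n) * x @[n --> \oo] --> x.
    rewrite -[X in _ --> X]mul1r -[X in (X * _ : R^o)]subr0.
    apply: cvgMl; apply: cvgB; [exact: cvg_cst|exact: cvg_harmonic].
  case: r {r1 r2 hr} @u => a b /=; exact: cvg_pair (lim a) (lim b).
Unshelve. all: by end_near. Qed.

(** Strictness is stated for 0 < q < 1/2 because the regions coincide at the endpoints: both are the
    origin at q = 0, and both are the triangle R1 + R2 <= 1 at q = 1/2. *)
Theorem mainTheorem3 (R : realType) (q : R) (hq : 0 <= q <= 2^-1) :
  R_BSL q `<=` capacity_region q /\
  (0 < q < 2^-1 -> R_BSL q `<` capacity_region q).
Proof.
have l2 : 0 < ln 2 :> R by rewrite ln_gt0 // ltr1n.
have pos_case : 0 < q -> R_BSL q `<=` capacity_region q.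
  move=> q0; have hq' : 0 < q <= 2^-1 by rewrite q0; case/andP: hq.
  have [rho [c [hr c0 hc le _]]] := single_letter_sum_rate_gap R q hq'.
  move=> r /(R_BSL_sub_triangle R rho c q hr c0 hc)[r1 r2 rK].
  by apply: triangle_sub_capacity => //; split => //; exact: le_trans rK le.
split.
  case/andP: (hq); rewrite le_eqVlt => /predU1P[q0 _|q0 _]; last exact: pos_case.
  (* At q = 0 any [rho] with (1 + rho)^2 <= 2 allows c = 0; the sum rate is then at most 0 and only
     the origin remains. *)
  have h3 : 0 < (3^-1 : R) <= 1 by lra.
  have h43 : 2 * ln (1 + 3^-1 : R) - ln 2 <= 0.
    rewrite subr_le0 mulr_natl -lnXn; last lra.
    by rewrite ler_ln ?posrE // ?exprn_gt0 //; lra.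
  move=> r /(R_BSL_sub_triangle R _ 0 q h3 (lexx _) h43)[r1 r2].
  rewrite -q0 mulr0 subr0 => rK.
  have rs : r.1 + r.2 <= 0 by rewrite -(pmulr_lle0 _ l2).
  have -> : r = (0, 0).
    by case: r r1 r2 rs {rK} => a b /= a0 b0 ab; congr (_, _); lra.
  apply: subset_closure; split => //=.
  have code n := exists_trivial_code R 0 n (lexx _).
  exists (fun n => projT1 (cid (code n))); split.
  - by apply: cvg_near_cst; near=> n; case: (cid (code n)) => c [].
  - by apply: cvg_near_cst; near=> n; case: (cid (code n)) => c [].
  - by apply: cvg_near_cst; near=> n; case: (cid (code n)) => c [].
move=> /andP[q0 q2]; split; first exact: pos_case.
have hq' : 0 < q <= 2^-1 by rewrite q0 ltW.
have [rho [c [hr c0 hc _ /(_ q2) lt]]] := single_letter_sum_rate_gap R q hq'.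
(* The separating pair gives user 1 the whole sum rate h(q), above the single-letter bound. *)
move=> sub; pose r : R^o * R^o := (bin_entropy q / ln 2, 0).
have q01 : 0 <= q <= 1 by apply/andP; split; lra.
have : capacity_region q r.
  apply: triangle_sub_capacity => //; split => //=.
    by rewrite divr_ge0 ?bin_entropy_ge0 // ltW.
  by rewrite addr0 divfK // gt_eqF.
move=> /sub/(R_BSL_sub_triangle R rho c q hr c0 hc)[_ _] /=.
by rewrite addr0 divfK ?gt_eqF // leNgt lt.
Unshelve. all: by end_near. Qed.
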